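(* The following are equivalent: (1) The Urysohn sphere $\mathbf{S}$ is oscillation stable (equivalently, approximately indivisible). (2) For every strictly positive integer $m$, the space $\mathbf{S}_m$ is $1/m$-indivisible. (3) For every strictly positive integer $m$, the space $\mathbf{S}_m$ is indivisible.
   Context: A metric space is ultrahomogeneous when every isometry between two of its finite subspaces extends to an isometry of the space onto itself. The Urysohn sphere $\mathbf{S}$ is, up to isometry, the unique complete separable ultrahomogeneous metric space of diameter $1$ into which every separable metric space of diameter at most $1$ embeds isometrically. For an integer $m\geqslant 1$, let $[0,1]_m=\{k/m:k\in\{0,\dots,m\}\}$; $\mathbf{S}_m$ is, up to isometry, the unique countable ultrahomogeneous metric space with distances in $[0,1]_m$ into which every countable metric space with distances in $[0,1]_m$ embeds isometrically. For a metric space $\mathbf{X}=(X,d^{\mathbf{X}})$, $Y\subset X$ and $\varepsilon\geqslant 0$, let $(Y)_\varepsilon=\{x\in X:\exists y\in Y\ d^{\mathbf{X}}(x,y)\leqslant\varepsilon\}$. The space $\mathbf{X}$ is $\varepsilon$-indivisible when for every integer $k\geqslant 1$ and every map $\chi:\mathbf{X}\to k=\{0,\dots,k-1\}$, there are $i<k$ and a subspace $\widetilde{\mathbf{X}}\subset\mathbf{X}$ isometric to $\mathbf{X}$ such that $\widetilde{\mathbf{X}}\subset(\chi^{-1}(\{i\}))_\varepsilon$. It is indivisible when it is $0$-indivisible, and approximately indivisible when it is $\varepsilon$-indivisible for every $\varepsilon>0$. The space $\mathbf{S}$ is oscillation stable when for every finite partition $\gamma$ of $\mathbf{S}$ and every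 $\varepsilon>0$ there is $A\in\gamma$ such that $(A)_\varepsilon$ includes an isometric copy of $\mathbf{S}$; this is the same as approximate indivisibility of $\mathbf{S}$. *)

(* Defs.v *)
From HB Require Import structures.
From mathcomp Require Import all_boot all_order all_algebra.
From mathcomp Require Import all_classical all_reals all_analysis.

Set Implicit Arguments.
Unset Strict Implicit.
Unset Printing Implicit Defensive.

Import Order.TTheory GRing.Theory Num.Theory.
Import numFieldNormedType.Exports.

Local Open Scope classical_set_scope.
Local Open Scope ring_scope.

Definition isometry_on {R : realType} {X Y : metricType R}
    (A : set X) (f : X -> Y) : Prop :=
  forall x y, A x -> A y -> mdist (f x) (f y) = mdist x y.

Definition isometry {R : realType} {X Y : metricType R} (f : X -> Y) : Prop :=
  isometry_on [set: X] f.

Definition embeds {R : realType} (X Y : metricType R) : Prop :=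
  exists f : X -> Y, isometry f.

(* The subspace [A] of [Y] is isometric to [X]. *)
Definition isometric_copy {R : realType} (X : metricType R) {Y : metricType R}
    (A : set Y) : Prop :=
  exists2 f : X -> Y, isometry f & range f = A.

(* An isometry between the finite subspaces [A] and [f @` A] is given by a
   total function [f] whose values outside [A] are irrelevant. *)
Definition ultrahomogeneous {R : realType} (X : metricType R) : Prop :=
  forall (A : set X) (f : X -> X), finite_set A -> isometry_on A f ->
    exists g : X -> X,
      [/\ isometry g, range g = [set: X] & forall x, A x -> g x = f x].

(* Extended-real valued; the diameter of the empty space is [-oo]. *)
Definition diameter {R : realType} (X : metricType R) : \bar R :=
  ereal_sup [set (mdist xy.1 xy.2)%:E | xy in [set: X * X]].

Definition separable {R : realType} (X : metricType R) : Prop :=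
  exists2 D : set X, countable D & dense D.

(* The library's [completeType] and [cvg] require a base point; this is the
   same property without it. *)
Definition complete_space {R : realType} (X : metricType R) : Prop :=
  forall F : set_system X, ProperFilter F -> cauchy F ->
    exists x : X, F --> x.

Definition urysohn_sphere {R : realType} (S : metricType R) : Prop :=
  [/\ complete_space S, separable S, ultrahomogeneous S, diameter S = 1%:E
    & forall X : metricType R,
        separable X -> (diameter X <= 1%:E)%E -> embeds X S].

Definition grid {R : realType} (m : nat) : set R :=
  [set k%:R / m%:R | k in [set k : nat | (k <= m)%N]].

Definition distances_in {R : realType} (X : metricType R) (D : set R) : Prop :=
  forall x y : X, D (mdist x y).

Definition urysohn_grid_space {R : realType} (m : nat) (S : metricType R)
    : Prop :=
  [/\ countable [set: S], distances_in S (grid m), ultrahomogeneous S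
    & forall X : metricType R,
        countable [set: X] -> distances_in X (grid m) -> embeds X S].

Definition fattening {R : realType} {X : metricType R} (Y : set X) (e : R)
    : set X :=
  [set x | exists2 y, Y y & mdist x y <= e].

Definition eps_indivisible {R : realType} (e : R) (X : metricType R) : Prop :=
  forall k : nat, (0 < k)%N -> forall chi : X -> 'I_k,
    exists i : 'I_k, exists2 X' : set X,
      isometric_copy X X' & X' `<=` fattening (chi @^-1` [set i]) e.

Definition indivisible {R : realType} (X : metricType R) : Prop :=
  eps_indivisible 0 X.

Definition approximately_indivisible {R : realType} (X : metricType R) : Prop :=
  forall e : R, 0 < e -> eps_indivisible e X.

Definition oscillation_stable {R : realType} (X : metricType R) : Prop :=
  forall gamma : set (set X), finite_set gamma -> partition gamma id [set: X] ->
    forall e : R, 0 < e ->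
      exists2 A : set X, gamma A &
        exists2 X' : set X, isometric_copy X X' & X' `<=` fattening A e.

(* Main.v *)
Require Import Defs.
From HB Require Import structures.
From mathcomp Require Import all_boot all_order all_algebra.
From mathcomp Require Import all_classical all_reals all_analysis.
From mathcomp Require Import lra.

Set Implicit Arguments.
Unset Strict Implicit.
Unset Printing Implicit Defensive.

Import Order.TTheory GRing.Theory Num.Theory.
Import numFieldNormedType.Exports.

Local Open Scope classical_set_scope.
Local Open Scope ring_scope.

(* (1) => (3).  Rounding the distances of a dense sequence D of S up to
   multiples of 1/m gives a countable space, embedded by phi in S_m.  A colouring
   of S_m pulls back along phi to D, hence, up to a small error, to S.  An almost
   monochromatic copy of S contains a copy of S_m with distances shrunk by a
   factor slightly below 1; moving its points to D and rounding up recovers the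
   distances of S_m exactly, so phi yields a monochromatic copy of S_m in S_m.

   (2) => (1).  S_m is extended to a countable metric space W by a tree of
   points, one for each finite sequence in S_m that looks like an initial segment
   of D with rounded distances.  Every copy Y of S_m inside S_m contains D with
   rounded distances, so a branch of the tree isometric to D runs next to Y.
   Colour the copy of S_m in a copy of W in S, take an almost monochromatic Y,
   and complete its branch to a copy of S.  The metric of W is the supremum of
   |g a - g b| over the functions g that satisfy the desired upper bounds;
   inf-convolutions show that these bounds are attained. *)

(** * Pseudometrics and their metric quotients *)

Record pseudometric (R : realType) (T : Type) := Pseudometric {
  pdist :> T -> T -> R;
  pdistxx : forall x, pdist x x = 0;
  pdist_sym : forall x y, pdist x y = pdist y x;
  pdist_triangle : forall y x z, pdist x z <= pdist x y + pdist y z }.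

Section MetricQuotient.
Context {R : realType} {T : choiceType} (d : pseudometric R T).

(** The value of [choose] depends only on the zero-distance class, so each class gets one
    representative. The quotient can then be a subtype of [T], with no set of classes. *)
Definition pdist_repr (x : T) : T := choose (fun y => `[< d x y = 0 >]) x.

Lemma pdist_reprE x : d x (pdist_repr x) = 0.
Proof.
by have /asboolP := @chooseP _ (fun y => `[< d x y = 0 >]) x
  (asboolT (pdistxx d x)).
Qed.

Lemma pdist_congr x x' y y' : d x x' = 0 -> d y y' = 0 -> d x y = d x' y'.
Proof.
move=> xx' yy'.
have := pdist_triangle d x' x y; have := pdist_triangle d y' x' y.
have := pdist_triangle d x x' y'; have := pdist_triangle d y x y'.
rewrite (pdist_sym d x' x) (pdist_sym d y' y) xx' yy'; lra.
Qed.

Lemma eq_pdist_repr x y : d x y = 0 -> pdist_repr x = pdist_repr y.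
Proof.
move=> xy; rewrite /pdist_repr.
have -> : (fun z => `[< d x z = 0 >]) = (fun z => `[< d y z = 0 >]).
  by apply/funext => z; rewrite (pdist_congr xy (pdistxx d z)).
by apply: choose_id; apply: asboolT; rewrite ?pdistxx // pdist_sym.
Qed.

Lemma pdist_repr_idem x : pdist_repr (pdist_repr x) == pdist_repr x.
Proof. by rewrite -(eq_pdist_repr (pdist_reprE x)). Qed.

Definition metric_quotient := {x : T | pdist_repr x == x}.
HB.instance Definition _ := Choice.on metric_quotient.

Definition to_quotient (x : T) : metric_quotient :=
  exist _ (pdist_repr x) (pdist_repr_idem x).

Let mdist (x y : metric_quotient) : R := d (val x) (val y).

Let mdist_eq0 (x y : metric_quotient) : mdist x y = 0 -> x = y.
Proof.
move=> /eq_pdist_repr xy; apply: val_inj.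
by rewrite -(eqP (valP x)) -(eqP (valP y)).
Qed.

HB.instance Definition _ := @isMetric.Build R metric_quotient mdist
  (fun x => pdistxx d (val x)) mdist_eq0
  (fun x y => pdist_sym d (val x) (val y))
  (fun y x z => pdist_triangle d (val y) (val x) (val z)).

Lemma to_quotientE (x y : T) :
  metric_structure.mdist (to_quotient x) (to_quotient y) = d x y.
Proof. by symmetry; apply: pdist_congr; apply: pdist_reprE. Qed.

End MetricQuotient.

(** Universality, assumed for metric spaces only, is carried over to pseudometrics: the map factors
    through the quotient and may identify points. *)
Lemma pseudometric_embeds {R : realType} (X : metricType R) (D : set R)
    (T : choiceType) (d : pseudometric R T) :
  (forall Y : metricType R,
     countable [set: Y] -> distances_in Y D -> embeds Y X) ->
  countable [set: T] -> (forall x y, D (d x y)) ->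
  exists f : T -> X, forall x y, mdist (f x) (f y) = d x y.
Proof.
move=> univ cT dD; have [] := univ (metric_quotient d).
- have /countable_injP[f finj] := cT.
  apply/countable_injP; exists (f \o val) => x y _ _ /=.
  by move=> /finj xy; apply: val_inj; apply: xy; rewrite inE.
- by move=> x y; apply: dD.
- move=> f fiso; exists (f \o to_quotient d) => x y.
  by rewrite /= fiso // to_quotientE.
Qed.

(** * Dense sequences and completion of isometries *)

Lemma dense_sequence {R : realType} (X : metricType R) (x0 : X) :
  separable X ->
  exists x : nat -> X, forall y (e : R), 0 < e -> exists i, mdist (x i) y < e.
Proof.
move=> [D /countable_injP[f finj] Ddense].
(* This inverts the injection [f]; numbers that code no point of [D] are sent to [x0]. *)
pose x n := xget x0 [set t | D t /\ f t = n].
exists x => y e e0.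
have [t [/interior_subset + Dt]] : (ball y e)^° `&` D !=set0.
  apply: Ddense; last exact: open_interior.
  by exists y; exact: nbhsx_ballx.
rewrite ballEmdist /= => yt; exists (f t).
have : [set t' | D t' /\ f t' = f t] (x (f t)) by apply: xgetPex; exists t.
move=> [Dx /finj -> //]; rewrite ?inE //.
by rewrite metric_sym.
Qed.

(** The [z]-images of small balls around [s] generate a Cauchy filter, because [z] preserves
    distances; [h s] is its limit. The second conclusion lets one index approximate [s] and [h s] at
    once. *)
Lemma dense_isometry_extends {R : realType} (X Y : metricType R) (I : Type)
    (x : I -> X) (z : I -> Y) :
  complete_space Y ->
  (forall s (e : R), 0 < e -> exists i, mdist (x i) s < e) ->
  (forall i j, mdist (z i) (z j) = mdist (x i) (x j)) ->
  exists2 h : X -> Y, Defs.isometry h &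
    forall s (e : R), 0 < e ->
      exists i, mdist (x i) s < e /\ mdist (z i) (h s) < e.
Proof.
move=> Ycomplete xdense zx.
have /choice[h hP] : forall s, exists t, forall e : R, 0 < e ->
    exists i, mdist (x i) s < e /\ mdist (z i) t < e.
  move=> s.
  pose B (e : R) := z @` [set i | mdist (x i) s < e].
  pose F := filter_from [set e : R | 0 < e] B.
  have FF : ProperFilter F.
    apply: filter_from_proper.
      apply: filter_from_filter; first by exists 1; rewrite /= ltr01.
      move=> e e' /= e0 e0'; exists (Num.min e e').
        by rewrite /= lt_min e0 e0'.
      by move=> _ [i /= + <-]; rewrite lt_min => /andP[ie ie']; split; exists i.
    by move=> e /= /xdense-/(_ s)[i ie]; exists (z i), i.
  have [t Ft] : exists t : Y, F --> t.
    apply: Ycomplete; apply: cauchy_exP => e e0.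
    have [i ie] := xdense s (e / 2) ltac:(lra).
    exists (z i), (e / 2) => /=; first lra.
    move=> _ [j /= je <-]; rewrite ballEmdist /= zx.
    have := metric_triangle (x i) s (x j); rewrite (metric_sym s); lra.
  exists t => e e0.
  have [e' /= e'0 /= eB] : F (ball t e) by apply: Ft; exact: nbhsx_ballx.
  have [] := xdense s (Num.min e e'); first by rewrite lt_min e0.
  move=> i; rewrite lt_min => /andP[ie ie']; exists i; split=> //.
  have : ball t e (z i) by apply: eB; exists i.
  by rewrite ballEmdist /= metric_sym.
exists h => // s t _ _.
(* The two distances differ by at most four errors, two in [X] and two in [Y], each below
   [e / 4]. *)
apply/eqP; rewrite -subr_eq0 -normr_le0; apply/ler_addgt0Pl => e e0.
have [i [xi zi]] := hP s (e / 4) ltac:(lra).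
have [j [xj zj]] := hP t (e / 4) ltac:(lra).
have := zx i j.
have := metric_triangle (z i) (h s) (z j).
have := metric_triangle (h s) (h t) (z j).
have := metric_triangle (h s) (z i) (h t).
have := metric_triangle (z i) (z j) (h t).
have := metric_triangle (x i) s (x j).
have := metric_triangle s t (x j).
have := metric_triangle s (x i) t.
have := metric_triangle (x i) (x j) t.
rewrite (metric_sym (h s) (z i)) (metric_sym (h t) (z j)).
rewrite (metric_sym s (x i)) (metric_sym t (x j)) => *.
rewrite ler_norml; apply/andP; split; lra.
Qed.

(** * Colourings and partitions *)

Lemma eps_indivisible_le {R : realType} (X : metricType R) (e e' : R) :
  e <= e' -> eps_indivisible e X -> eps_indivisible e' X.
Proof.
move=> ee' Xe k k0 chi; have [i [X' copy sub]] := Xe k k0 chi.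
exists i, X' => // x /sub[y chiy xy]; exists y => //.
exact: le_trans ee'.
Qed.

Lemma oscillation_stableP {R : realType} (X : metricType R) (x0 : X) :
  oscillation_stable X <-> approximately_indivisible X.
Proof.
split=> [osc e e0 k k0 chi|ind gamma gfin [gcov gtriv gne] e e0].
- pose gamma := [set A | exists2 i, A = chi @^-1` [set i] & A !=set0].
  have gfin : finite_set gamma.
    apply: (@sub_finite_set _ _ [set chi @^-1` [set i] | i in [set: 'I_k]]).
      by move=> A [i -> _]; exists i.
    exact: finite_image finite_finset.
  have gpart : partition gamma id [set: X].
    split=> [|_ _ [i -> _] [j -> _] [x [/= <- <-]] //|A [] //].
    apply/seteqP; split=> // x _; exists (chi @^-1` [set chi x]) => //.
    by exists (chi x) => //; exists x.
  have [_ [i -> _] [X' copy sub]] := osc gamma gfin gpart e e0.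
  by exists i, X'.
- have [n /card_set_bijP[f fbij]] := gfin.
  have [A0 gA0 A0x0] : cover gamma id x0 by rewrite gcov.
  have /choice[b bP] : forall x, exists A, gamma A /\ A x.
    move=> x; have [A gA Ax] : cover gamma id x by rewrite gcov.
    by exists A.
  have ltf A : gamma A -> (f A < n)%N by move=> gA; have [/(_ _ gA)] := fbij.
  have n0 : (0 < n)%N by case: n {gfin fbij} ltf => // /(_ _ gA0).
  have [i [X' copy sub]] :=
    ind e e0 n n0 (fun x => Ordinal (ltf _ (bP x).1)).
  (* A point of the copy shows that colour [i] occurs, and hence which member of [gamma] it
     numbers. *)
  have [x] : X' !=set0 by have [g _ <-] := copy; exists (g x0), x0.
  move=> /sub[y /= yi _]; exists (b y); first exact: (bP y).1.
  exists X' => // z /sub[z' /= z'i zz']; exists z' => //.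
  suff <- : b z' = b y by exact: (bP z').2.
  have [_ finj _] := fbij.
  apply: finj; rewrite ?inE; try exact: (bP _).1.
  by have /(congr1 val) := etrans z'i (esym yi).
Qed.

(** * Rounding up to multiples of [1/m] *)

Section GridCeil.
Context {R : realType} (m : nat) (m_gt0 : (0 < m)%N).
Implicit Types a b : R.

Definition grid_ceil a : R := (Num.ceil (a * m%:R))%:~R / m%:R.

Let m0 : 0 < m%:R :> R. Proof. by rewrite ltr0n. Qed.

Lemma grid_ceil_ge a : a <= grid_ceil a.
Proof. by rewrite ler_pdivlMr // ceil_ge. Qed.

Lemma grid_ceil_lt a : grid_ceil a < a + m%:R^-1.
Proof.
rewrite ltr_pdivrMr // mulrDl mulVf ?gt_eqF //.
have := ceilB1_lt (a * m%:R); rewrite rmorphB /=; lra.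
Qed.

Lemma grid_ceil0 : grid_ceil 0 = 0.
Proof. by rewrite /grid_ceil mul0r ceil0 mul0r. Qed.

Lemma le_grid_ceil a b : a <= b -> grid_ceil a <= grid_ceil b.
Proof.
move=> ab; rewrite ler_pM2r ?invr_gt0 // ler_int le_ceil //.
by rewrite ler_pM2r.
Qed.

(** A sum of two ceilings is an integer above the sum. This is what preserves the triangle
    inequality under rounding. *)
Lemma grid_ceilD a b : grid_ceil (a + b) <= grid_ceil a + grid_ceil b.
Proof.
rewrite -mulrDl ler_pM2r ?invr_gt0 // -rmorphD /= ler_int ceil_le_int.
by rewrite rmorphD /= mulrDl lerD // ceil_ge.
Qed.

Lemma grid_ceil_grid a : 0 <= a <= 1 -> grid m (grid_ceil a).
Proof.
move=> /andP[a0 a1].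
have c0 : 0 <= Num.ceil (a * m%:R).
  by rewrite ceil_ge0 (lt_le_trans (ltrN10 _)) // mulr_ge0 // ltW.
exists `|Num.ceil (a * m%:R)|%N; last first.
  by rewrite /grid_ceil -[in RHS](gez0_abs c0).
rewrite /= -lez_nat gez0_abs // ceil_le_int.
by rewrite ler_piMl // ltW.
Qed.

(** This is how an approximate distance becomes exact: any error that stays in this interval
    disappears. *)
Lemma grid_ceil_eq a k :
  k%:R / m%:R - m%:R^-1 < a <= k%:R / m%:R -> grid_ceil a = k%:R / m%:R.
Proof.
move=> /andP[ka ak]; congr (_ / _); rewrite (@ceil_def _ _ k%:Z) //.
rewrite -ler_pdivlMr // ak andbT -ltr_pdivrMr // rmorphB /=.
by rewrite mulrBl mul1r.
Qed.

End GridCeil.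

(** * Pullback, rounding and scaling of pseudometrics *)

Definition pullback_pseudometric {R : realType} {X : metricType R} {T : Type}
    (x : T -> X) : pseudometric R T :=
  @Pseudometric R T (fun s t => mdist (x s) (x t)) (fun s => mdistxx (x s))
    (fun s t => metric_sym (x s) (x t))
    (fun t s u => metric_triangle (x s) (x t) (x u)).

Section CeilPseudometric.
Context {R : realType} {T : Type} (m : nat) (m_gt0 : (0 < m)%N).
Context (d : pseudometric R T).

Let dist (x y : T) : R := grid_ceil m (d x y).

Let distxx x : dist x x = 0. Proof. by rewrite /dist pdistxx grid_ceil0. Qed.

Let dist_sym x y : dist x y = dist y x. Proof. by rewrite /dist pdist_sym. Qed.

Let dist_triangle y x z : dist x z <= dist x y + dist y z.
Proof.
apply: le_trans (grid_ceilD m_gt0 _ _).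
exact/le_grid_ceil/pdist_triangle.
Qed.

Definition ceil_pseudometric : pseudometric R T :=
  Pseudometric distxx dist_sym dist_triangle.

End CeilPseudometric.

Section ScalePseudometric.
Context {R : realType} {T : Type} (c : R) (c_ge0 : 0 <= c).
Context (d : pseudometric R T).

Let dist (x y : T) : R := c * d x y.

Let distxx x : dist x x = 0. Proof. by rewrite /dist pdistxx mulr0. Qed.

Let dist_sym x y : dist x y = dist y x. Proof. by rewrite /dist pdist_sym. Qed.

Let dist_triangle y x z : dist x z <= dist x y + dist y z.
Proof. by rewrite -mulrDr ler_wpM2l // pdist_triangle. Qed.

Definition scale_pseudometric : pseudometric R T :=
  Pseudometric distxx dist_sym dist_triangle.

End ScalePseudometric.

(** * From the sphere to the grid spaces *)

Section Sphere.
Context {R : realType} (S : metricType R) (hS : urysohn_sphere S).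

Lemma sphere_nonempty : exists s : S, True.
Proof.
have [_ _ _ diamS _] := hS.
apply: contrapT => S0; move: diamS; rewrite /diameter.
suff -> : [set (mdist xy.1 xy.2)%:E | xy in [set: S * S]] = set0.
  by rewrite ereal_sup0.
by apply/seteqP; split=> [_ [[s t] _ <-]|//]; case: S0; exists s.
Qed.

Lemma sphere_mdist_le1 (s t : S) : mdist s t <= 1.
Proof.
have [_ _ _ diamS _] := hS.
rewrite -lee_fin -diamS; apply: ereal_sup_ubound.
by exists (s, t).
Qed.

Lemma sphere_dense_sequence :
  exists x : nat -> S, forall y (e : R), 0 < e -> exists i, mdist (x i) y < e.
Proof.
have [s _] := sphere_nonempty; have [_ sepS _ _ _] := hS.
exact: dense_sequence.
Qed.

Lemma sphere_embeds (T : choiceType) (d : pseudometric R T) :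
  countable [set: T] -> (forall x y, d x y <= 1) ->
  exists f : T -> S, forall x y, mdist (f x) (f y) = d x y.
Proof.
have [_ _ _ _ univ] := hS.
apply: (@pseudometric_embeds _ _ [set r | r <= 1]) => Y cY dY.
apply: univ.
- exists [set: Y] => // O [y Oy] _; by exists y.
- by apply: ge_ereal_sup => _ [[x y] _ <-]; rewrite lee_fin; apply: dY.
Qed.

Lemma grid_space_mdist_le1 (m : nat) (N : metricType R) (x y : N) :
  (0 < m)%N -> urysohn_grid_space m N -> mdist x y <= 1.
Proof.
move=> m0 [_ dN _ _]; have [k km <-] := dN x y.
by rewrite ler_pdivrMr ?ltr0n // mul1r ler_nat.
Qed.

Lemma grid_space_embeds_ceil (m : nat) (N : metricType R) (x : nat -> S) :
  (0 < m)%N -> urysohn_grid_space m N ->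
  exists phi : nat -> N,
    forall i j, mdist (phi i) (phi j) = grid_ceil m (mdist (x i) (x j)).
Proof.
move=> m0 [_ _ _ univ].
apply: (@pseudometric_embeds _ _ _ nat
  (ceil_pseudometric m0 (pullback_pseudometric x)) univ) => [|i j].
  exact: countableP.
by apply: grid_ceil_grid => //=; rewrite mdist_ge0 sphere_mdist_le1.
Qed.

(* Shrinking all distances of [N] by the factor [1 - (4m)^-1] leaves enough room
   for rounding up to the grid to undo small perturbations. *)
Lemma approximately_indivisible_grid (m : nat) (N : metricType R) :
  (0 < m)%N -> urysohn_grid_space m N -> approximately_indivisible S ->
  indivisible N.
Proof.
move=> m0 hN Sind k k0 chi.
have [x xdense] := sphere_dense_sequence.
have [phi phiE] := grid_space_embeds_ceil x m0 hN.
pose u : R := m%:R^-1.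
have u0 : 0 < u by rewrite invr_gt0 ltr0n.
have u1 : u <= 1 by rewrite invf_le1 ?ltr0n // ler1n.
have c0 : 0 <= 1 - u / 4 by lra.
have [theta thetaE] : exists theta : N -> S,
    forall a b, mdist (theta a) (theta b) = (1 - u / 4) * mdist a b.
  have [cN _ _ _] := hN.
  apply: (sphere_embeds (d := scale_pseudometric c0 (pullback_pseudometric id)))
    => [//|a b /=].
  rewrite mulr_ile1 ?mdist_ge0 ?(grid_space_mdist_le1 _ _ m0 hN) //; lra.
(* Four errors of size [e] add up to [u * (u / 4)], which is what shrinking takes off the least
   nonzero distance [u]. *)
pose e := u ^+ 2 / 16.
have e0 : 0 < e by rewrite divr_gt0 // exprn_gt0.
have e4 : 4 * e = u * (u / 4) by rewrite /e expr2; lra.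
have /choice[p pP] : forall s, exists i, mdist (x i) s < e.
  by move=> s; apply: xdense.
(* A point [s] of the sphere gets the colour of the rounded image of a nearby dense point
   [x (p s)]. *)
have [i [_ [h hiso <-] hsub]] := Sind e e0 k k0 (fun s => chi (phi (p s))).
have /choice[q qP] : forall a, exists s,
    chi (phi (p s)) = i /\ mdist (h (theta a)) s <= e.
  move=> a; have [|s /= si hs] := hsub (h (theta a)); first by exists (theta a).
  by exists s.
exists i, (range (fun a => phi (p (q a)))); last first.
  move=> _ [a _ <-]; exists (phi (p (q a))); last by rewrite mdistxx.
  exact: (qP a).1.
exists (fun a => phi (p (q a))) => // a b _ _; rewrite phiE.
have [_ dN _ _] := hN; have [l lm lab] := dN a b.
(* Distance zero is treated apart, since a positive perturbation of it would round up to [1/m]; here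
   the two points coincide. *)
have [l0|lpos] := posnP l.
  move: lab; rewrite l0 mul0r => /esym/mdist_positivity ->.
  by rewrite !mdistxx grid_ceil0.
rewrite -lab; apply: grid_ceil_eq => //; rewrite -/u in lab *.
have : mdist (h (theta a)) (h (theta b)) = (1 - u / 4) * (l%:R * u).
  by rewrite hiso // thetaE lab.
have := (qP a).2; have := (qP b).2; have := pP (q a); have := pP (q b).
move: (h (theta a)) (h (theta b)) (q a) (q b) => ha hb qa qb.
have := metric_triangle (x (p qa)) qa (x (p qb)).
have := metric_triangle qa ha (x (p qb)).
have := metric_triangle ha hb (x (p qb)).
have := metric_triangle hb qb (x (p qb)).
have := metric_triangle ha qa hb.
have := metric_triangle qa (x (p qa)) hb.
have := metric_triangle (x (p qa)) (x (p qb)) hb.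
have := metric_triangle (x (p qb)) qb hb.
rewrite (metric_sym qa ha) (metric_sym qb hb).
rewrite (metric_sym qa (x _)) (metric_sym qb (x _)) => *.
(* With [L = l * u] in [[u, 1]], the perturbed distance is within [u ^ 2 / 4] of [L - u * L / 4],
   hence at most [L] and above [L - u]. The products are supplied because [lra] is linear. *)
have lu1 : u <= l%:R * u by rewrite ler_peMl ?ler1n // ltW.
have lu2 : l%:R * u <= 1 by rewrite lab (grid_space_mdist_le1 _ _ m0 hN).
have ul1 : u * u <= u * (l%:R * u) by rewrite ler_pM2l.
have ul2 : u * (l%:R * u) <= u by rewrite ger_pMr.
have uu : u * u <= u by rewrite ger_pMr.
apply/andP; split; lra.
Qed.

End Sphere.

(** * Infima capped at 1 *)

Section CappedInf.
Context {R : realType} {I : Type} (P : set I) (F : I -> R).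

(* The added element [1] caps the values and avoids [inf set0 = 0]. *)
Definition capped_inf : R := inf (1 |` [set F i | i in P]).

Lemma le_capped_inf c :
  c <= 1 -> (forall i, P i -> c <= F i) -> c <= capped_inf.
Proof.
move=> c1 cF; apply: lb_le_inf; first by exists 1; left.
by move=> _ [->//|[i Pi <-]]; exact: cF.
Qed.

Hypothesis F_ge0 : forall i, P i -> 0 <= F i.

Let has_lb : has_lbound (1 |` [set F i | i in P]).
Proof. by exists 0 => _ [->//|[i Pi <-]]; exact: F_ge0. Qed.

Lemma capped_inf_le1 : capped_inf <= 1.
Proof. by apply: ge_inf => //; left. Qed.

Lemma capped_inf_le i : P i -> capped_inf <= F i.
Proof. by move=> Pi; apply: ge_inf => //; right; exists i. Qed.

Lemma capped_inf_ge0 : 0 <= capped_inf.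
Proof. by apply: le_capped_inf. Qed.

End CappedInf.

(** * The tree of finite sequences over a grid space *)

Section TreeExtension.
Context {R : realType} {N : metricType R} {T : eqType}.
Context (r : pseudometric R nat) (h : T -> nat) (u : T -> nat -> N) (e : R).
Hypothesis N_le1 : forall x y : N, mdist x y <= 1.
Hypothesis r_ge0 : forall i j, 0 <= r i j.
Hypothesis r_le1 : forall i j, r i j <= 1.
Hypothesis e_ge0 : 0 <= e.
Implicit Types (s t q : T) (x y : N).

(* A node [s] of height [h s] stands for the finite sequence
   [u s 0, ..., u s (h s)]; it is put at distance at most [2 * e] from [top s],
   and at distance [r (h s) (h t)] from every comparable node [t]. *)
Definition good_node s : Prop := forall i j, (i <= h s)%N -> (j <= h s)%N ->
  r i j <= mdist (u s i) (u s j) <= r i j + e.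

Definition agree_upto s t (i : nat) : Prop :=
  [/\ (i <= h s)%N, (i <= h t)%N & forall j, (j <= i)%N -> u s j = u t j].

Definition comparable_nodes s t : Prop := agree_upto s t (minn (h s) (h t)).

Definition top s : N := u s (h s).

Lemma comparable_sym s t : comparable_nodes s t -> comparable_nodes t s.
Proof.
move=> [ps pt st]; split; rewrite minnC // => j jm.
by rewrite st.
Qed.

Lemma comparable_refl s : comparable_nodes s s.
Proof. by split; rewrite ?geq_minl ?geq_minr. Qed.

Lemma agree_trans q s t i j : agree_upto q s i -> agree_upto s t j ->
  agree_upto q t (minn i j).
Proof.
move=> [iq is_ qs] [js jt st]; split.
- by apply: leq_trans iq; rewrite geq_minl.
- by apply: leq_trans jt; rewrite geq_minr.
- by move=> l; rewrite leq_min => /andP[li lj]; rewrite qs // st.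
Qed.

(** The cost of descending from [s] to a common initial segment of height [i] and climbing to [t],
    minimised over [i] and capped at 1. *)
Definition tree_dist s t : R :=
  capped_inf [set i | agree_upto s t i] (fun i => r (h s) i + r i (h t)).

Let sum_ge0 s t i : agree_upto s t i -> 0 <= r (h s) i + r i (h t).
Proof. by move=> _; rewrite addr_ge0. Qed.

Lemma tree_dist_ge0 s t : 0 <= tree_dist s t.
Proof. exact: capped_inf_ge0 (@sum_ge0 s t). Qed.

(** At the lower of the two heights one leg has length zero; elsewhere the triangle inequality for
    [r] applies. *)
Lemma tree_dist_comparable s t : comparable_nodes s t ->
  tree_dist s t = r (h s) (h t).
Proof.
move=> st; apply/eqP; rewrite eq_le; apply/andP; split.
  apply: le_trans (capped_inf_le (@sum_ge0 s t) st) _.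
  by case: leqP => _; rewrite pdistxx ?addr0 ?add0r.
by apply: le_capped_inf => // i _; exact: pdist_triangle.
Qed.

Lemma tree_distxx s : tree_dist s s = 0.
Proof. by rewrite tree_dist_comparable ?pdistxx //; exact: comparable_refl. Qed.

Lemma tree_dist_lipschitz q s t : comparable_nodes s t ->
  tree_dist q t <= tree_dist q s + r (h s) (h t).
Proof.
move=> st; rewrite -lerBlDr; apply: le_capped_inf => [|i qs].
  by rewrite lerBlDr (le_trans (capped_inf_le1 (@sum_ge0 q t))) // lerDl.
rewrite lerBlDr.
apply: le_trans (capped_inf_le (@sum_ge0 q t) (agree_trans qs st)) _.
case: leqP => [_|lt_i].
  by rewrite -addrA lerD2l pdist_triangle.
(* Here [t] lies below the meeting level [i] of [q] and [s], so it is itself an initial segment of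
   [q]. *)
have -> : minn (h s) (h t) = h t.
  have [_ is_ _] := qs; apply/minn_idPr; rewrite leqNgt; apply/negP => lt_st.
  by move: lt_i; rewrite (minn_idPl (ltnW lt_st)) ltnNge is_.
rewrite pdistxx addr0.
apply: le_trans (pdist_triangle r i _ _) _; rewrite -addrA lerD2l.
exact: pdist_triangle.
Qed.

(** Both legs pass through a shared term of the sequences, and each is at most [e] longer in [N]
    than in the tree. *)
Lemma tree_dist_top s t : good_node s -> good_node t ->
  mdist (top s) (top t) <= tree_dist s t + 2 * e.
Proof.
move=> gs gt; rewrite -lerBlDr; apply: le_capped_inf => [|i [is_ it st]].
  by have := N_le1 (top s) (top t); have := e_ge0; lra.
have /andP[_ us] := gs (h s) i (leqnn _) is_.
have /andP[_ ut] := gt i (h t) it (leqnn _).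
have := metric_triangle (top s) (u s i) (top t).
rewrite {2}st // /top; have := e_ge0; lra.
Qed.

(** Both tops are terms of the longer sequence, where the lower bound of [good_node] holds. *)
Lemma comparable_top s t : good_node s -> good_node t -> comparable_nodes s t ->
  r (h s) (h t) <= mdist (top s) (top t).
Proof.
move=> gs gt [ms mt st]; rewrite /top.
have [le_st|/ltnW le_ts] := leqP (h s) (h t).
  rewrite st ?leq_min ?leqnn //.
  by have /andP[] := gt (h s) (h t) le_st (leqnn _).
rewrite -st ?leq_min ?leqnn ?andbT //.
by have /andP[] := gs (h s) (h t) (leqnn _) le_ts.
Qed.

(** * The metric on the base space together with the tree *)

Definition admissible (g : N + T -> R) : Prop :=
  [/\ forall w, 0 <= g w <= 1,
      forall x y, `|g (inl x) - g (inl y)| <= mdist x y,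
      forall s t, good_node s -> good_node t -> comparable_nodes s t ->
        `|g (inr s) - g (inr t)| <= r (h s) (h t)
    & forall s, good_node s -> `|g (inr s) - g (inl (top s))| <= 2 * e].

(** This is the path metric, capped at 1, of the graph whose weighted edges are the constraints in
    [admissible]. In this dual form upper bounds are immediate, and a lower bound needs one
    function. *)
Definition tree_sup (a b : N + T) : R :=
  sup [set `|g a - g b| | g in admissible].

Let admissible0 : admissible (fun=> 0).
Proof.
split=> *; rewrite ?subrr ?normr0 ?lexx ?ler01 ?mdist_ge0 //.
by rewrite mulr_ge0.
Qed.

Let tree_sup_ne a b : [set `|g a - g b| | g in admissible] !=set0.
Proof. by eexists; exists (fun=> 0); [exact: admissible0|]. Qed.

Let admissible_dist g a b : admissible g -> `|g a - g b| <= 1.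
Proof.
move=> [g01 _ _ _]; have /andP[a0 a1] := g01 a; have /andP[b0 b1] := g01 b.
by rewrite ler_norml; apply/andP; split; have := e_ge0; lra.
Qed.

Lemma tree_sup_le a b c :
  (forall g, admissible g -> `|g a - g b| <= c) -> tree_sup a b <= c.
Proof.
by move=> gc; apply: ge_sup => // _ [g /gc gabc <-].
Qed.

Lemma tree_sup_ge g a b : admissible g -> `|g a - g b| <= tree_sup a b.
Proof.
move=> gadm; apply: ub_le_sup; last by exists g.
by exists 1 => _ [g' gadm' <-]; exact: admissible_dist.
Qed.

Let tree_supxx a : tree_sup a a = 0.
Proof.
apply/eqP; rewrite eq_le; apply/andP; split.
  by apply: tree_sup_le => g _; rewrite subrr normr0.
by have := tree_sup_ge a a admissible0; rewrite subrr normr0.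
Qed.

Let tree_sup_sym a b : tree_sup a b = tree_sup b a.
Proof.
by rewrite /tree_sup; congr sup; apply: eq_imagel => g _; rewrite distrC.
Qed.

Let tree_sup_triangle b a c : tree_sup a c <= tree_sup a b + tree_sup b c.
Proof.
apply: tree_sup_le => g gadm; apply: le_trans (ler_distD (g b) _ _) _.
by rewrite lerD // tree_sup_ge.
Qed.

Definition tree_pseudometric : pseudometric R (N + T) :=
  Pseudometric tree_supxx tree_sup_sym tree_sup_triangle.

Lemma tree_pseudometric_le1 a b : tree_pseudometric a b <= 1.
Proof. by apply: tree_sup_le => g gadm; exact: admissible_dist. Qed.

(** Makes [phi] Lipschitz along branches without raising it at good nodes. *)
Definition inf_convolution (phi : T -> R) s : R :=
  capped_inf good_node (fun q => phi q + tree_dist q s).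

Definition tree_fun x (phi : T -> R) (w : N + T) : R :=
  match w with inl y => mdist x y | inr s => inf_convolution phi s end.

Section InfConvolution.
Context (phi : T -> R) (phi_ge0 : forall q, 0 <= phi q).

Let summand_ge0 s q : good_node q -> 0 <= phi q + tree_dist q s.
Proof. by move=> _; rewrite addr_ge0 // tree_dist_ge0. Qed.

Lemma inf_convolution_ge0 s : 0 <= inf_convolution phi s.
Proof. exact: capped_inf_ge0 (@summand_ge0 s). Qed.

Lemma inf_convolution_le s : good_node s -> inf_convolution phi s <= phi s.
Proof.
move=> gs; apply: le_trans (capped_inf_le (@summand_ge0 s) gs) _.
by rewrite tree_distxx addr0.
Qed.

Lemma inf_convolution_lipschitz s t : comparable_nodes s t ->
  inf_convolution phi t <= inf_convolution phi s + r (h s) (h t).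
Proof.
move=> st; rewrite -lerBlDr; apply: le_capped_inf => [|q gq]; rewrite lerBlDr.
  by rewrite (le_trans (capped_inf_le1 (@summand_ge0 t))) // lerDl.
apply: le_trans (capped_inf_le (@summand_ge0 t) gq) _.
by rewrite -addrA lerD2l tree_dist_lipschitz.
Qed.

(** The delicate constraint links a node to its top. The first hypothesis bounds the convolution
    from above; the second bounds every term of its infimum from below. *)
Lemma tree_fun_admissible x :
  (forall q, good_node q -> phi q <= mdist x (top q) + 2 * e) ->
  (forall q s, good_node q -> good_node s ->
     mdist x (top s) - 2 * e <= phi q + tree_dist q s) ->
  admissible (tree_fun x phi).
Proof.
move=> phi_le phi_ge; split.
- case=> [y|s] /=; first by rewrite mdist_ge0 N_le1.
  by rewrite inf_convolution_ge0 (capped_inf_le1 (@summand_ge0 s)).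
- move=> y z /=; rewrite ler_norml.
  have := metric_triangle x y z; have := metric_triangle x z y.
  rewrite (metric_sym z y) => *; apply/andP; split; have := e_ge0; lra.
- move=> s t _ _ st /=; rewrite ler_norml.
  have := inf_convolution_lipschitz st.
  have := inf_convolution_lipschitz (comparable_sym st).
  rewrite (pdist_sym r (h t)) => *; apply/andP; split; have := e_ge0; lra.
- move=> s gs /=; rewrite ler_norml; apply/andP; split.
    rewrite -lerBlDr opprK addrC; apply: le_capped_inf => [|q gq].
      by have := N_le1 x (top s); have := e_ge0; lra.
    exact: phi_ge.
  by rewrite lerBlDr addrC (le_trans (inf_convolution_le gs)) // phi_le.
Qed.

End InfConvolution.

Lemma tree_pseudometric_base x y :
  tree_pseudometric (inl x) (inl y) = mdist x y.
Proof.
apply/eqP; rewrite eq_le; apply/andP; split.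
  by apply: tree_sup_le => g [_ + _ _]; exact.
(* The distance to [x], extended to nodes through their tops, attains the bound. *)
have adm : admissible (tree_fun x (fun q => mdist x (top q))).
  apply: tree_fun_admissible => [q|q _|q s gq gs]; first exact: mdist_ge0.
    by rewrite lerDl mulr_ge0.
  have := tree_dist_top gq gs.
  have := metric_triangle x (top q) (top s); have := e_ge0; lra.
have := tree_sup_ge (inl x) (inl y) adm.
by rewrite /= mdistxx sub0r normrN ger0_norm // mdist_ge0.
Qed.

Lemma tree_pseudometric_branch s t :
  good_node s -> good_node t -> comparable_nodes s t ->
  tree_pseudometric (inr s) (inr t) = r (h s) (h t).
Proof.
move=> gs gt st; apply/eqP; rewrite eq_le; apply/andP; split.
  by apply: tree_sup_le => g [_ _ + _]; exact.
(* Zero at [s], and elsewhere the largest value allowed by the top constraint. The term [q = s] of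
   the convolution at [t] is exactly [r (h s) (h t)]; in the others [2 * e] absorbs the loss in
   [tree_dist_top]. *)
pose phi q := if q == s then 0 else mdist (top s) (top q) + 2 * e.
have e2 : 0 <= 2 * e by rewrite mulr_ge0.
have phi_ge0 q : 0 <= phi q.
  by rewrite /phi; case: ifP => // _; rewrite addr_ge0 // mdist_ge0.
have adm : admissible (tree_fun (top s) phi).
  apply: tree_fun_admissible => // [q _|q q' gq gq']; rewrite /phi; case: eqP.
  - by move=> _; rewrite addr_ge0 // mdist_ge0.
  - by [].
  - by move=> ->; have := tree_dist_top gs gq'; have := e_ge0; lra.
  - move=> _; have := tree_dist_top gq gq'.
    have := metric_triangle (top s) (top q) (top q'); have := e_ge0; lra.
apply: le_trans (tree_sup_ge (inr s) (inr t) adm).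
have -> : tree_fun (top s) phi (inr s) = 0.
  apply/eqP; rewrite eq_le inf_convolution_ge0 // andbT.
  by rewrite (le_trans (inf_convolution_le phi_ge0 gs)) // /phi eqxx.
rewrite sub0r normrN ger0_norm ?inf_convolution_ge0 //.
apply: le_capped_inf => // q gq; rewrite /phi; case: eqP => [->|_].
  by rewrite add0r tree_dist_comparable.
have := comparable_top gs gt st; have := tree_dist_top gq gt.
have := metric_triangle (top s) (top q) (top t); have := e_ge0; lra.
Qed.

Lemma tree_pseudometric_top s : good_node s ->
  tree_pseudometric (inr s) (inl (top s)) <= 2 * e.
Proof. by move=> gs; apply: tree_sup_le => g [_ _ _ +]; exact. Qed.

End TreeExtension.

(** * From the grid spaces to the sphere *)

Lemma countable_sum_seq (N : choiceType) :
  countable [set: N] -> countable [set: N + seq N].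
Proof.
move=> /countable_injP[f finj].
have {}finj : injective f by move=> a b; apply: finj; rewrite inE.
apply/countable_injP.
exists (fun w => pickle (match w with
  | inl y => inl (f y)
  | inr s => inr (map f s)
  end : nat + seq nat)) => a b _ _ /(pcan_inj pickleK).
case: a b => [a|s] [b|t] // [].
  by move=> /finj ->.
by move=> /(inj_map finj) ->.
Qed.

Lemma grid_approximately_indivisible {R : realType} (S : metricType R)
    (Sm : nat -> metricType R) :
  urysohn_sphere S ->
  (forall m : nat, (0 < m)%N -> urysohn_grid_space m (Sm m)) ->
  (forall m : nat, (0 < m)%N -> eps_indivisible (1 / m%:R) (Sm m)) ->
  approximately_indivisible S.
Proof.
move=> hS hSm ind eps eps0 k k0 chi.
(* The final error is at most [4 / m]: one unit to the dense branch, two from a node to its top, one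
   from indivisibility of [N]. *)
pose m := Num.bound (4 / eps).
have bm : 4 / eps < m%:R by apply: archi_boundP; rewrite divr_ge0 // ltW.
have m0 : (0 < m)%N.
  by rewrite -(ltr0n R) (lt_trans _ bm) // divr_gt0.
pose e : R := m%:R^-1.
have e0 : 0 < e by rewrite invr_gt0 ltr0n.
have e4 : 4 * e <= eps.
  by rewrite ler_pdivrMr ?ltr0n // mulrC -ler_pdivrMr // ltW.
have hN := hSm m m0; set N := Sm m in hN *.
have [x xdense] := sphere_dense_sequence hS.
have [phi phiE] := grid_space_embeds_ceil hS x m0 hN.
(* The height is the last index, so [top] is the last term; the empty sequence behaves like the
   single term [phi 0]. *)
pose h (s : seq N) := (size s).-1.
pose u (s : seq N) := nth (phi 0%N) s.
have N_le1 (a b : N) : mdist a b <= 1 := grid_space_mdist_le1 a b m0 hN.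
pose r := pullback_pseudometric x.
have r_ge0 i j : 0 <= r i j := mdist_ge0 _ _.
have r_le1 i j : r i j <= 1 := sphere_mdist_le1 hS _ _.
pose d := tree_pseudometric h u r_ge0 (ltW e0).
have [f fE] : exists f : N + seq N -> S, forall a b, mdist (f a) (f b) = d a b.
  apply: (sphere_embeds hS) => [|a b]; last exact: tree_pseudometric_le1.
  by apply: countable_sum_seq; have [cN _ _ _] := hN.
have [i [_ [j jiso <-] jsub]] := ind m m0 k k0 (fun y => chi (f (inl y))).
(* The branch follows the rounded dense sequence inside the copy given by [j]. Its nodes are good
   because rounding adds less than [e]. *)
pose t n := mkseq (fun l => j (phi l)) n.+1.
have ht n : h (t n) = n by rewrite /h size_mkseq.
have ut n l : (l <= n)%N -> u (t n) l = j (phi l).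
  by move=> ln; rewrite /u nth_mkseq.
have tgood n : good_node r h u e (t n).
  move=> a b; rewrite ht => an bn; rewrite !ut // jiso // phiE.
  by rewrite grid_ceil_ge // ltW // grid_ceil_lt.
have tcomp n l : comparable_nodes h u (t n) (t l).
  split; rewrite !ht ?geq_minl ?geq_minr // => a.
  by rewrite leq_min => /andP[an al]; rewrite !ut.
have zE n l : mdist (f (inr (t n))) (f (inr (t l))) = mdist (x n) (x l).
  by rewrite fE tree_pseudometric_branch // !ht.
have [Scomplete _ _ _ _] := hS.
(* The branch reproduces the distances of the dense sequence, so completing it gives a copy of the
   sphere. *)
have [g giso gP] := dense_isometry_extends Scomplete xdense zE.
exists i, (range g); first by exists g.
move=> _ [s _ <-]; have [n [_ zg]] := gP s e e0.
have [|y /= yi jy] := jsub (j (phi n)); first by exists (phi n).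
exists (f (inl y)) => //.
have zj : mdist (f (inr (t n))) (f (inl (j (phi n)))) <= 2 * e.
  have := tree_pseudometric_top r_ge0 (ltW e0) (tgood n).
  by rewrite fE /top ht ut.
have jy' : mdist (f (inl (j (phi n)))) (f (inl y)) <= e.
  by rewrite fE tree_pseudometric_base // -[e]mul1r.
have := metric_triangle (g s) (f (inr (t n))) (f (inl y)).
have := metric_triangle (f (inr (t n))) (f (inl (j (phi n)))) (f (inl y)).
rewrite (metric_sym (g s) (f (inr _))); lra.
Qed.

Theorem theorem3 (R : realType) (S : metricType R) (Sm : nat -> metricType R)
    (hS : urysohn_sphere S)
    (hSm : forall m : nat, (0 < m)%N -> urysohn_grid_space m (Sm m)) :
  [/\ oscillation_stable S <-> approximately_indivisible S,
      oscillation_stable S <->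
        (forall m : nat, (0 < m)%N -> eps_indivisible (1 / m%:R) (Sm m))
    & (forall m : nat, (0 < m)%N -> eps_indivisible (1 / m%:R) (Sm m)) <->
        (forall m : nat, (0 < m)%N -> indivisible (Sm m))].
Proof.
have [s _] := sphere_nonempty hS.
have oscP := oscillation_stableP s.
have approx_indiv : approximately_indivisible S ->
    forall m : nat, (0 < m)%N -> indivisible (Sm m).
  by move=> ind m m0; exact: (approximately_indivisible_grid hS m0 (hSm m m0)).
have indiv_eps : (forall m : nat, (0 < m)%N -> indivisible (Sm m)) ->
    forall m : nat, (0 < m)%N -> eps_indivisible (1 / m%:R) (Sm m).
  by move=> ind m m0; apply: eps_indivisible_le (ind m m0); rewrite divr_ge0.
have eps_approx := grid_approximately_indivisible hS hSm.
split=> //; split.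
- by move=> /oscP/approx_indiv.
- by move=> /eps_approx/oscP.
- by move=> /eps_approx.
- exact: indiv_eps.
Qed.
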